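(* Let $a,b,c,d$ be commuting indeterminates. For a partition $\lambda=(\lambda_1,\lambda_2,\dots)$ (with $\lambda_m=0$ for $m$ larger than the number of parts), define \[ \alpha(\lambda)=\sum_{i\ge 1}\lceil \lambda_{2i-1}/2\rceil,\quad \beta(\lambda)=\sum_{i\ge1}\lfloor \lambda_{2i-1}/2\rfloor,\quad \gamma(\lambda)=\sum_{i\ge1}\lceil \lambda_{2i}/2\rceil,\quad \delta(\lambda)=\sum_{i\ge1}\lfloor \lambda_{2i}/2\rfloor, \] and $w(\lambda)=a^{\alpha(\lambda)}b^{\beta(\lambda)}c^{\gamma(\lambda)}d^{\delta(\lambda)}$. Let $\Phi(a,b,c,d)=\sum_{\lambda} w(\lambda)$, the sum over all integer partitions $\lambda$ (including the empty partition). Then, as formal power series, \[ \Phi(a,b,c,d) = \prod_{j=1}^\infty \frac{(1+a^{j}b^{j-1}c^{j-1}d^{j-1})(1+a^{j}b^{j}c^{j}d^{j-1})} {(1-a^{j}b^{j}c^{j}d^{j})(1-a^{j}b^{j}c^{j-1}d^{j-1}) (1-a^{j}b^{j-1}c^{j}d^{j-1})}. \]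
   Context: Equivalently, $w(\lambda)$ is the product of the entries of the Young diagram of $\lambda$ filled so that odd-numbered rows read $a,b,a,b,\dots$ from left to right and even-numbered rows read $c,d,c,d,\dots$. *)

(* Defs.v *)
From HB Require Import structures.
From mathcomp Require Import all_boot all_order all_algebra.
From mathcomp Require Import boolp.
From mathcomp Require Import mpoly.

Set Implicit Arguments.
Unset Strict Implicit.
Unset Printing Implicit Defensive.

Import GRing.Theory.
Local Open Scope ring_scope.

(* The ring R[[X_0, ..., X_(n-1)]] of formal power series in n commuting
   indeterminates: a series is an arbitrary family of coefficients indexed by
   exponent vectors. The record keeps the Cauchy product apart from the
   pointwise product of functions. *)
Record fps (n : nat) (R : comNzRingType) := Fps { fcoef : 'X_{1..n} -> R }.

HB.instance Definition _ n R := gen_eqMixin (fps n R).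
HB.instance Definition _ n R := gen_choiceMixin (fps n R).

Section FpsRing.
Variables (n : nat) (R : comNzRingType).
Implicit Types (f g h : fps n R) (m : 'X_{1..n}).

Lemma fpsP f g : fcoef f =1 fcoef g <-> f = g.
Proof.
split=> [|->] //; case: f g => f [g] /= /funext fg.
by rewrite fg.
Qed.

Definition fzero : fps n R := Fps (fun=> 0).
Definition fone : fps n R := Fps (fun m => (m == 0%MM)%:R).
Definition fadd f g : fps n R := Fps (fun m => fcoef f m + fcoef g m).
Definition fopp f : fps n R := Fps (fun m => - fcoef f m).

(* The sum runs over all pairs (k.1, k.2) with k.1 + k.2 = m; the degree bounds
   only serve to make the index type finite. *)
Definition fmul f g : fps n R := Fps (fun m =>
  \sum_(k : 'X_{1..n < (mdeg m).+1, (mdeg m).+1} | m == (k.1 + k.2)%MM)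
     fcoef f k.1 * fcoef g k.2).

Fact faddA : associative fadd.
Proof. by move=> f g h; apply/fpsP=> m /=; rewrite addrA. Qed.

Fact faddC : commutative fadd.
Proof. by move=> f g; apply/fpsP=> m /=; rewrite addrC. Qed.

Fact fadd0 : left_id fzero fadd.
Proof. by move=> f; apply/fpsP=> m /=; rewrite add0r. Qed.

Fact faddN : left_inverse fzero fopp fadd.
Proof. by move=> f; apply/fpsP=> m /=; rewrite addNr. Qed.

HB.instance Definition _ :=
  GRing.isZmodule.Build (fps n R) faddA faddC fadd0 faddN.

Definition ftrunc (d : nat) f : {mpoly R[n]} :=
  \sum_(m : 'X_{1..n < d.+1}) fcoef f m *: 'X_[m].

Fact ftruncE d f m : (mdeg m <= d)%N -> (ftrunc d f)@_m = fcoef f m.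
Proof. by move=> md; rewrite /ftrunc mcoeff_mpoly. Qed.

Fact fmulE f g (p q : {mpoly R[n]}) m :
    (forall k, (mdeg k <= mdeg m)%N -> p@_k = fcoef f k) ->
    (forall k, (mdeg k <= mdeg m)%N -> q@_k = fcoef g k) ->
  fcoef (fmul f g) m = (p * q)@_m.
Proof.
move=> pf qg; rewrite mcoeffM /=; apply: eq_bigr => k _.
by rewrite pf ?qg // -ltnS bmdeg.
Qed.

Fact fmulA : associative fmul.
Proof.
move=> f g h; apply/fpsP=> m; set d := mdeg m.
have tr f' : forall k, (mdeg k <= d)%N -> (ftrunc d f')@_k = fcoef f' k.
  by move=> k; apply: ftruncE.
have trM f' g' k : (mdeg k <= d)%N ->
    (ftrunc d f' * ftrunc d g')@_k = fcoef (fmul f' g') k.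
  by move=> kd; symmetry; apply: fmulE => l lk; apply: tr; apply: leq_trans kd.
rewrite (fmulE (tr f) (trM g h)) (fmulE (trM f g) (tr h)).
by rewrite mulrA.
Qed.

Fact fmulC : commutative fmul.
Proof.
move=> f g; apply/fpsP=> m.
have tr f' k : (mdeg k <= mdeg m)%N -> (ftrunc (mdeg m) f')@_k = fcoef f' k.
  exact: ftruncE.
by rewrite (fmulE (tr f) (tr g)) (fmulE (tr g) (tr f)) mulrC.
Qed.

Fact fmul1 : left_id fone fmul.
Proof.
move=> f; apply/fpsP=> m.
have tr k : (mdeg k <= mdeg m)%N -> (ftrunc (mdeg m) f)@_k = fcoef f k.
  exact: ftruncE.
by rewrite (@fmulE _ _ 1 _ m _ tr) ?mul1r ?tr // => k _; rewrite mcoeff1.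
Qed.

Fact fmulDl : left_distributive fmul fadd.
Proof.
move=> f g h; apply/fpsP=> m /=; rewrite -big_split /=.
by apply: eq_bigr => k _; rewrite mulrDl.
Qed.

Fact fone_neq0 : fone != 0.
Proof.
apply/eqP => /fpsP/(_ 0%MM)/eqP /=.
by rewrite eqxx oner_eq0.
Qed.

HB.instance Definition _ := GRing.Zmodule_isComNzRing.Build (fps n R)
  fmulA fmulC fmul1 fmulDl fone_neq0.

(* f^-1 is the multiplicative inverse of f when f has one, and f otherwise. *)
Definition funit : {pred fps n R} := fun f => `[< exists g, g * f = 1 >].

Definition finv f : fps n R :=
  if pselect (exists g, g * f = 1) is left ex then projT1 (cid ex) else f.

Fact fmulV : {in funit, left_inverse 1 finv *%R}.
Proof.
move=> f /asboolP fU; rewrite /finv; case: pselect => // ex.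
exact: projT2 (cid ex).
Qed.

Fact funitP f g : g * f = 1 -> funit f.
Proof. by move=> gf; apply/asboolP; exists g. Qed.

Fact finv_out : {in [predC funit], finv =1 id}.
Proof.
move=> f /negP fU; rewrite /finv; case: pselect => // ex.
by case: fU; apply/asboolP.
Qed.

HB.instance Definition _ := GRing.ComNzRing_hasMulInverse.Build (fps n R)
  fmulV funitP finv_out.

Definition fvar (i : 'I_n) : fps n R := Fps (fun m => (m == U_(i)%MM)%:R).

(* Convergence for the product topology with discrete coefficients: every
   coefficient is eventually constant. *)
Definition fps_lim (u : nat -> fps n R) (l : fps n R) : Prop :=
  forall m, exists N : nat, forall k, (N <= k)%N -> fcoef (u k) m = fcoef l m.

(* The infinite product, over j >= 1, of the F j. *)
Definition fps_prod (F : nat -> fps n R) (p : fps n R) : Prop :=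
  fps_lim (fun N => \prod_(1 <= j < N.+1) F j) p.

(* The unordered sum of a summable family: for every exponent vector m, only
   finitely many members (all listed in s) have a nonzero coefficient at m, and
   these coefficients add up to that of the sum. *)
Definition fps_sum (I : eqType) (F : I -> fps n R) (S : fps n R) : Prop :=
  forall m, exists s : seq I,
    [/\ uniq s,
        forall i, i \notin s -> fcoef (F i) m = 0 &
        fcoef S m = \sum_(i <- s) fcoef (F i) m].

Lemma fps_lim_unique u l l' : fps_lim u l -> fps_lim u l' -> l = l'.
Proof.
move=> ul ul'; apply/fpsP=> m; have [N lN] := ul m; have [N' lN'] := ul' m.
by rewrite -(lN (maxn N N')) ?leq_maxl // lN' // leq_maxr.
Qed.

Lemma fps_sum_unique (I : eqType) (F : I -> fps n R) S S' :
  fps_sum F S -> fps_sum F S' -> S = S'.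
Proof.
move=> FS FS'; apply/fpsP=> m.
have [s [us s0 ->]] := FS m; have [s' [us' s'0 ->]] := FS' m.
have nz (r : seq I) : \sum_(i <- r) fcoef (F i) m =
    \sum_(i <- [seq i <- r | fcoef (F i) m != 0]) fcoef (F i) m.
  rewrite big_filter [LHS](bigID (fun i => fcoef (F i) m == 0)) /=.
  by rewrite big1 ?add0r // => i /eqP.
rewrite nz [RHS]nz; apply/perm_big/uniq_perm; rewrite ?filter_uniq // => i.
rewrite !mem_filter; case: eqP => //= Fi.
have -> : i \in s by apply: contra_notT Fi => /s0.
by symmetry; apply: contra_notT Fi => /s'0.
Qed.

End FpsRing.

Arguments fvar {n} R i.

Definition is_intpart (s : seq nat) : bool := sorted geq s && (0%N \notin s).

(* An integer partition is the list of its positive parts, in weakly decreasing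
   order. *)
Definition intpart := {s : seq nat | is_intpart s}.

Section Weight.
Implicit Type l : intpart.
Local Open Scope nat_scope.

(* The m-th part, for m >= 1, which is 0 beyond the number of parts. *)
Definition part l (m : nat) : nat := nth 0 (val l) m.-1.

(* The terms with i greater than the number of parts vanish. *)
Definition alpha l := \sum_(1 <= i < (size (val l)).+1) uphalf (part l (2 * i - 1)).
Definition beta l := \sum_(1 <= i < (size (val l)).+1) half (part l (2 * i - 1)).
Definition gamma l := \sum_(1 <= i < (size (val l)).+1) uphalf (part l (2 * i)).
Definition delta l := \sum_(1 <= i < (size (val l)).+1) half (part l (2 * i)).

End Weight.

Definition weight (A : comNzRingType) (a b c d : A) (l : intpart) : A :=
  a ^+ alpha l * b ^+ beta l * c ^+ gamma l * d ^+ delta l.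

(* Main.v *)
(* Let x = ab, y = cd, Q = abcd, and let phi_N be the generating function of the
   partitions with parts at most N. Removing the largest part exchanges (a, b)
   with (c, d), which gives a linear system for phi_N(a, b, c, d) and
   phi_N(c, d, a, b). Eliminating the latter over two steps, the series
   U_j = (ac; Q)_j phi_2j satisfies
     (1 - Q^(j+1)) U_(j+1) = (1 + x + (a + cx) Q^j) U_j
                             - x (1 - ac Q^(j-1)) U_(j-1),
   that is, U(t) = sum_j U_j t^j satisfies
     (1 - t) (1 - xt) U(t) = (1 + at) (1 + cxt) U(Qt).
   Hence P(t) = (1 - t) U(t), whose partial sums of coefficients are the U_j,
   satisfies (1 - Qt) (1 - xt) P(t) = (1 + at) (1 + cxt) P(Qt). Iterating this
   from t = 1 gives (ac; Q)_oo Phi = P(1) as an infinite product. *)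

Require Import Defs.
From mathcomp Require Import all_boot all_order all_algebra.
From mathcomp Require Import mpoly.
From mathcomp Require Import ring.

Set Implicit Arguments.
Unset Strict Implicit.
Unset Printing Implicit Defensive.

Import GRing.Theory.
Local Open Scope ring_scope.

(** * Recurrences for the generating functions with bounded parts *)

Definition row_weight (A : nzSemiRingType) (a b : A) k :=
  a ^+ uphalf k * b ^+ half k.

(* [pgf N] is the generating function of the partitions with parts at most N:
   a partition with largest part N arises by adding the row N to a partition
   with parts at most N, whose rows then change parity. Applying this twice and
   solving for [pgf N] gives the quotient below. *)
Fixpoint pgf (A : comUnitRingType) N (a b c d : A) : A :=
  if N is N'.+1 then
    (pgf N' a b c d + row_weight a b N * pgf N' c d a b)
      / (1 - row_weight a b N * row_weight c d N)
  else 1.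

Arguments pgf A N%_N a b c d : simpl never.

Section Recurrence.
Variable A : comUnitRingType.
Implicit Types a b c d t : A.

Lemma pgfSE N a b c d :
    1 - row_weight a b N.+1 * row_weight c d N.+1 \is a GRing.unit ->
  (1 - row_weight a b N.+1 * row_weight c d N.+1) * pgf N.+1 a b c d
  = pgf N a b c d + row_weight a b N.+1 * pgf N c d a b.
Proof. by move=> u; rewrite mulrC /pgf divrK. Qed.

(** Follows from [pgfSE] and its copy with the pairs exchanged. This is the combinatorial form:
    either no part equals [N.+1], or removing one such part leaves parts at most [N.+1] in rows of
    exchanged parity. *)
Lemma pgfS N a b c d :
    1 - row_weight a b N.+1 * row_weight c d N.+1 \is a GRing.unit ->
  pgf N.+1 a b c d = pgf N a b c d + row_weight a b N.+1 * pgf N.+1 c d a b.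
Proof.
move=> u1.
have u2 : 1 - row_weight c d N.+1 * row_weight a b N.+1 \is a GRing.unit.
  by rewrite mulrC.
apply: (mulrI u1); move: (pgfSE u1) (pgfSE u2).
set u := row_weight a b _; set v := row_weight c d _.
set f := pgf N.+1 a b c d; set g := pgf N.+1 c d a b => -> e.
transitivity ((1 - u * v) * pgf N a b c d + u * ((1 - v * u) * g)); last by ring.
by rewrite e; ring.
Qed.

Lemma row_weight_even a b j : row_weight a b j.*2 = (a * b) ^+ j.
Proof. by rewrite /row_weight uphalf_double doubleK exprMn. Qed.

Lemma row_weight_odd a b j : row_weight a b j.*2.+1 = a * (a * b) ^+ j.
Proof. by rewrite /row_weight /= uphalf_double doubleK exprMn exprS mulrA. Qed.

Lemma pgf_doubleS a b c d j :
    1 - (a * b * (c * d)) ^+ j.+1 \is a GRing.unit ->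
    1 - a * c * (a * b * (c * d)) ^+ j \is a GRing.unit ->
  (1 - (a * b * (c * d)) ^+ j.+1)
    * (1 - a * c * (a * b * (c * d)) ^+ j) * pgf j.+1.*2 a b c d
  = (1 + c * (a * b) * (a * b * (c * d)) ^+ j) * pgf j.*2 a b c d
    + (a + a * b) * (a * b) ^+ j * pgf j.*2 c d a b.
Proof.
move=> u1 u2.
have e1 : 1 - row_weight a b j.*2.+1 * row_weight c d j.*2.+1
          = 1 - a * c * (a * b * (c * d)) ^+ j.
  by rewrite !row_weight_odd [in RHS]exprMn; ring.
have e2 : 1 - row_weight a b j.+1.*2 * row_weight c d j.+1.*2
          = 1 - (a * b * (c * d)) ^+ j.+1.
  by rewrite !row_weight_even -exprMn.
have e3 : 1 - row_weight c d j.*2.+1 * row_weight a b j.*2.+1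
          = 1 - a * c * (a * b * (c * d)) ^+ j.
  by rewrite mulrC.
have e4 : row_weight a b j.*2.+2 = (a * b) ^+ j.+1
  by rewrite -doubleS row_weight_even.
rewrite doubleS in e2 *.
have := pgfSE (N := j.*2.+1) (a := a) (b := b) (c := c) (d := d).
have := pgfSE (N := j.*2) (a := a) (b := b) (c := c) (d := d).
have := pgfSE (N := j.*2) (a := c) (b := d) (c := a) (d := b).
rewrite e1 e2 e3 e4 !row_weight_odd => /(_ u2) h1 /(_ u2) h2 /(_ u1) h3.
rewrite mulrAC h3 mulrDl [_ * (1 - _ * _)]mulrC h2 [_ * (1 - _)]mulrC.
rewrite [_ * (_ ^+ _ * _)]mulrCA h1 exprS [in RHS]exprMn.
ring.
Qed.

Variables a b c d : A.
Let x := a * b.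
Let y := c * d.
Let q := x * y.
Hypothesis qU : forall j, 1 - q ^+ j.+1 \is a GRing.unit.
Hypothesis acqU : forall j, 1 - a * c * q ^+ j \is a GRing.unit.

(* [pgf_num j] is U_j, [dpgf_num j] is the coefficient U_j - U_(j-1) of P. *)
Definition pgf_num j := \prod_(i < j) (1 - a * c * q ^+ i) * pgf j.*2 a b c d.

Lemma pgf_num1 : (1 - q) * pgf_num 1 = 1 + x + a + c * x.
Proof.
have := pgf_doubleS (j := 0) (qU 0) (acqU 0).
rewrite /pgf_num big_ord_recl big_ord0 /= !expr0 expr1 !mulr1 -/x -/y -/q.
move=> e; transitivity (1 + c * x + (a + x)); last by ring.
by rewrite -{}e; ring.
Qed.

Lemma pgf_numSS j : (1 - q ^+ j.+2) * pgf_num j.+2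
  = (1 + x + (a + c * x) * q ^+ j.+1) * pgf_num j.+1
    - x * (1 - a * c * q ^+ j) * pgf_num j.
Proof.
have e0 := pgf_doubleS (qU j) (acqU j).
have e1 := pgf_doubleS (qU j.+1) (acqU j.+1).
have qC : c * d * (a * b) = q by rewrite mulrC.
have qU' : 1 - (c * d * (a * b)) ^+ j.+1 \is a GRing.unit by rewrite qC.
have acqU' : 1 - c * a * (c * d * (a * b)) ^+ j \is a GRing.unit.
  by rewrite qC mulrC [c * a]mulrC mulrC.
have e2 := pgf_doubleS qU' acqU'.
rewrite qC -/x -/y -/q in e0 e1 e2.
rewrite /pgf_num !big_ord_recr /=.
set P := \prod_(i < j) _.
suff: (1 - q ^+ j.+2) * (1 - a * c * q ^+ j.+1) * pgf j.+2.*2 a b c d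
  = (1 + x + (a + c * x) * q ^+ j.+1) * pgf j.+1.*2 a b c d
    - x * pgf j.*2 a b c d.
  move=> e; transitivity (P * (1 - a * c * q ^+ j) *
    ((1 - q ^+ j.+2) * (1 - a * c * q ^+ j.+1) * pgf j.+2.*2 a b c d)).
    by ring.
  by rewrite {}e; ring.
(* These factors make the relations at [j] applicable: [e1] expresses [f2] by [f1] and [g1], then
   [e2] trades [g1] for [g0] and [f0], and [e0'] trades [g0] for [f1] and [f0]. *)
apply: (mulrI (qU j)); apply: (mulrI (acqU j)).
move: e0 e1 e2; rewrite (exprS x j).
set f0 := pgf j.*2 a b c d; set g0 := pgf j.*2 c d a b.
set f1 := pgf j.+1.*2 a b c d; set g1 := pgf j.+1.*2 c d a b.
set f2 := pgf j.+2.*2 a b c d => e0 -> e2.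
have exy : x ^+ j * y ^+ j = q ^+ j by rewrite -exprMn.
transitivity ((1 + c * x * q ^+ j.+1)
     * ((1 - q ^+ j.+1) * (1 - a * c * q ^+ j) * f1)
   + x * (a + x) * x ^+ j * ((1 - q ^+ j.+1) * (1 - c * a * q ^+ j) * g1)).
  by ring.
rewrite {}e2.
have e0' : (a + x) * x ^+ j * g0 =
   (1 - q ^+ j.+1) * (1 - a * c * q ^+ j) * f1 - (1 + c * x * q ^+ j) * f0.
  by rewrite e0; ring.
transitivity ((1 + c * x * q ^+ j.+1)
     * ((1 - q ^+ j.+1) * (1 - a * c * q ^+ j) * f1)
   + x * (1 + a * y * q ^+ j) * ((a + x) * x ^+ j * g0) +
   x * (a + x) * (c + y) * (x ^+ j * y ^+ j) * f0).
  by ring.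
rewrite e0' exy !exprS; move: (q ^+ j) => z; rewrite /q; ring.
Qed.

(** * Functional equation for P(t) *)

Definition dpgf_num j := if j is j'.+1 then pgf_num j - pgf_num j' else 1.

Lemma pgf_num0 : pgf_num 0 = 1.
Proof. by rewrite /pgf_num big_ord0 mul1r. Qed.

Lemma sum_dpgf_num n : \sum_(j < n.+1) dpgf_num j = pgf_num n.
Proof.
elim: n => [|n IHn]; first by rewrite big_ord_recl big_ord0 addr0 pgf_num0.
by rewrite big_ord_recr IHn /= addrC subrK.
Qed.

Lemma dpgf_num1 : (1 - q) * dpgf_num 1 = q + x + a + c * x.
Proof. by rewrite mulrBr pgf_num1 pgf_num0; ring. Qed.

(** Compares the coefficients of t^(j+2) in (1 - qt) (1 - xt) P(t) = (1 + at) (1 + cxt) P(qt). *)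
Lemma dpgf_numSS j : (1 - q ^+ j.+2) * dpgf_num j.+2
  = (q + x + (a + c * x) * q ^+ j.+1) * dpgf_num j.+1
    + (a * c * x * q ^+ j - q * x) * dpgf_num j.
Proof.
case: j => [|j] /=.
  rewrite mulrBr pgf_numSS pgf_num0 expr0 expr1.
  have e := pgf_num1.
  transitivity ((1 + x + (a + c * x) * q) * pgf_num 1 - x * (1 - a * c)
    - (1 - q ^+ 2) * pgf_num 1 + q * ((1 - q) * pgf_num 1
    - (1 + x + a + c * x))).
    by rewrite e; ring.
  by ring.
have e1 := pgf_numSS j.+1; have e0 := pgf_numSS j.
(* The bracket after [q] vanishes by [e0]. Adding it reflects multiplying the equation for U(t) by 1
   - qt, where P(qt) = (1 - qt) U(qt). *)
transitivity ((1 - q ^+ j.+3) * pgf_num j.+3 - (1 - q ^+ j.+3) * pgf_num j.+2 +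
  q * ((1 - q ^+ j.+2) * pgf_num j.+2
    - ((1 + x + (a + c * x) * q ^+ j.+1) * pgf_num j.+1
    - x * (1 - a * c * q ^+ j) * pgf_num j))).
  by rewrite e0; ring.
by rewrite e1 !exprS; ring.
Qed.

(** Truncating P gives an exact identity for every [t], including 1, without convergence. The
    recurrences cancel all powers up to t^n; the right side is what remains in degrees n+1 and
    n+2. *)
Lemma dpgf_num_functional_eq n t :
  (1 - q * t) * (1 - x * t) * (\sum_(j < n.+1) dpgf_num j * t ^+ j)
   - (1 + a * t) * (1 + c * x * t) * (\sum_(j < n.+1) dpgf_num j * (q * t) ^+ j)
  = - t ^+ n.+1 * (1 - q ^+ n.+1) * dpgf_num n.+1
    + t ^+ n.+2 * x * (q - a * c * q ^+ n) * dpgf_num n.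
Proof.
elim: n => [|n IHn].
  rewrite !big_ord_recl !big_ord0 -(mulrA (- _)) !expr1 dpgf_num1 !expr0.
  by rewrite [dpgf_num _]/=; ring.
rewrite !(big_ord_recr n.+1) [nat_of_ord _]/=.
rewrite (mulrDr ((1 - _) * _)) (mulrDr ((1 + _) * _)) opprD addrACA IHn.
rewrite -(mulrA _ (1 - q ^+ n.+2)) (dpgf_numSS n) (exprMn _ q t) !exprS.
move: (dpgf_num n.+1) (dpgf_num n) => u v.
by ring.
Qed.

End Recurrence.

(** * Order of vanishing of power series *)

Section Order.
Variables (n : nat) (R : comNzRingType).
Implicit Types f g u : fps n R.

(** Membership in the k-th power of the ideal of the variables; convergence arguments become
    congruences modulo these powers. *)
Definition order_ge k f := forall m, (mdeg m < k)%N -> fcoef f m = 0.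

Lemma fcoefD f g m : fcoef (f + g) m = fcoef f m + fcoef g m.
Proof. by []. Qed.

Lemma fcoefN f m : fcoef (- f) m = - fcoef f m.
Proof. by []. Qed.

Lemma order_ge_lim (u : nat -> fps n R) f :
  (forall k, order_ge k (u k - f)) -> fps_lim u f.
Proof.
move=> uf m; exists (mdeg m).+1 => k km.
by apply/eqP; rewrite -subr_eq0 -fcoefN -fcoefD uf.
Qed.

Lemma order_ge0 f : order_ge 0 f.
Proof. by []. Qed.

Lemma order_geW k l f : (k <= l)%N -> order_ge l f -> order_ge k f.
Proof. by move=> kl lf m mk; apply/lf/leq_trans/kl. Qed.

Lemma order_geD k f g : order_ge k f -> order_ge k g -> order_ge k (f + g).
Proof. by move=> kf kg m mk; rewrite fcoefD kf ?kg ?addr0. Qed.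

Lemma order_geN k f : order_ge k f -> order_ge k (- f).
Proof. by move=> kf m mk; rewrite fcoefN kf ?oppr0. Qed.

Lemma order_geB k f g : order_ge k f -> order_ge k g -> order_ge k (f - g).
Proof. by move=> kf kg; apply/order_geD/order_geN. Qed.

Lemma order_ge_sum k (I : Type) (r : seq I) (F : I -> fps n R) :
  (forall i, order_ge k (F i)) -> order_ge k (\sum_(i <- r) F i).
Proof. by move=> kF; apply: big_ind => //; apply: order_geD. Qed.

Lemma order_geM k l f g :
  order_ge k f -> order_ge l g -> order_ge (k + l) (f * g).
Proof.
move=> kf lg m mkl; rewrite /= big1 // => -[p r] /= /eqP mE.
rewrite mE mdegD in mkl.
have [pk|kp] := ltnP (mdeg p) k; first by rewrite kf ?mul0r.
by rewrite lg ?mulr0 // -(ltn_add2l (mdeg p)) (leq_trans mkl) ?leq_add2r.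
Qed.

Lemma order_geMl k f g : order_ge k g -> order_ge k (f * g).
Proof. exact: (@order_geM 0). Qed.

Lemma order_geMr k f g : order_ge k f -> order_ge k (f * g).
Proof. by rewrite mulrC; apply: order_geMl. Qed.

Lemma order_geX k f i : order_ge k f -> order_ge (k * i) (f ^+ i).
Proof.
move=> kf; elim: i => [|i IHi]; first by rewrite muln0; apply: order_ge0.
by rewrite mulnS exprS; apply: order_geM.
Qed.

Lemma order_ge_fvar i : order_ge 1 (fvar R i).
Proof.
move=> m; rewrite ltnS leqn0 mdeg_eq0 /= => /eqP->.
by rewrite eq_sym -mdeg_eq0 mdeg1.
Qed.

Lemma order_geP f g : (forall k, order_ge k (f - g)) -> f = g.
Proof.
move=> fg; apply/fpsP => m.
by apply/eqP; rewrite -subr_eq0 -fcoefN -fcoefD (fg (mdeg m).+1).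
Qed.

(* The inverse is the geometric series, truncated at the degree of the
   coefficient that is being read. *)
Lemma order_ge_unit f : order_ge 1 f -> 1 - f \is a GRing.unit.
Proof.
move=> f1; pose g : fps n R :=
  Fps (fun m => fcoef (\sum_(i < (mdeg m).+1) f ^+ i) m).
suff gf : g * (1 - f) = 1 by apply/unitrPr; exists g; rewrite mulrC.
have gE k : order_ge k (g - \sum_(i < k) f ^+ i).
  move=> m mk; rewrite fcoefD fcoefN /=; apply/eqP; rewrite subr_eq0; apply/eqP.
  rewrite -!(big_mkord xpredT (fun i => f ^+ i)).
  rewrite [in RHS](@big_cat_nat _ _ _ (mdeg m).+1) // fcoefD.
  rewrite [X in _ = _ + X](_ : _ = 0) ?addr0 //.
  have : order_ge (mdeg m).+1 (\sum_((mdeg m).+1 <= i < k) f ^+ i); last exact.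
  rewrite big_nat_cond big_seq_cond; apply: big_ind => //.
    exact: order_geD.
  move=> i; rewrite andbT => /and3P[_ mi _]; rewrite -[i]mul1n in mi.
  exact: order_geW mi (order_geX f1).
apply: order_geP => k.
have -> : g * (1 - f) - 1
    = (g - \sum_(i < k) f ^+ i) * (1 - f) - f ^+ k.
  have := subrXX 1 f k; rewrite expr1n.
  under eq_bigr do rewrite expr1n mul1r.
  move=> e; rewrite mulrBl [_ * (1 - f) in X in _ = _ - X - _]mulrC -e.
  by ring.
apply: order_geB; first exact/order_geMr.
by have := order_geX (i := k) f1; rewrite mul1n.
Qed.

Lemma order_ge_unitM u f k :
  u \is a GRing.unit -> order_ge k (u * f) -> order_ge k f.
Proof. by move=> uU kf; rewrite -(mulKr uU f); apply: order_geMl. Qed.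

End Order.

(** * Weights row by row, and partitions in a box *)

Fixpoint row_weights (A : comNzRingType) (a b c d : A) (s : seq nat) : A :=
  if s is k :: s' then row_weight a b k * row_weights c d a b s' else 1.

(** Induction on [N] removes two rows at once, which restores the order of the pairs. [N] is only
    bounded below by the length, since a step lowers it by one and the length by two. *)
Lemma row_weightsE (A : comNzRingType) (a b c d : A) s N :
    (size s <= N)%N ->
  a ^+ (\sum_(i < N) uphalf (nth 0 s i.*2))
   * b ^+ (\sum_(i < N) half (nth 0 s i.*2))
   * c ^+ (\sum_(i < N) uphalf (nth 0 s i.*2.+1))
   * d ^+ (\sum_(i < N) half (nth 0 s i.*2.+1)) = row_weights a b c d s.
Proof.
elim: N s => [|N IHN] [|k [|l s]] //=.
- by rewrite !big_ord0 !mulr1.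
- by rewrite !big1 ?mulr1 // => i _; rewrite nth_nil.
- move=> _; rewrite !big_ord_recl /= !big1 ?addn0 ?mulr1 // => i _;
    by rewrite nth_nil.
rewrite ltnS => sN; rewrite !big_ord_recl /=.
rewrite /row_weight -IHN ?(ltnW sN) // !exprD.
by ring.
Qed.

Lemma weightE (A : comNzRingType) (a b c d : A) (l : intpart) :
  weight a b c d l = row_weights a b c d (val l).
Proof.
rewrite -(row_weightsE a b c d (leqnn _)) /weight /alpha /beta /gamma /delta.
rewrite !big_add1 !big_mkord /part.
by congr (_ ^+ _ * _ ^+ _ * _ ^+ _ * _ ^+ _);
  apply: eq_bigr => i _; congr (_ (nth _ _ _)); rewrite mulnS mul2n ?subn1.
Qed.

(** The recursion mirrors [pgfS]: either [N] is not a part, or one part [N] is removed and uses up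
    one of the [M] rows. The inner fixpoint lowers [N] at fixed [M]. *)
Fixpoint box (M : nat) : nat -> seq (seq nat) :=
  if M is M'.+1 then
    fix boxM N :=
      if N is N'.+1 then boxM N' ++ map (cons N) (box M' N) else [:: [::]]
  else fun=> [:: [::]].

Lemma boxSS M N : box M.+1 N.+1 = box M.+1 N ++ map (cons N.+1) (box M N.+1).
Proof. by []. Qed.

Lemma is_intpart_cons k s :
  is_intpart (k :: s) = [&& (0 < k)%N, (head 0 s <= k)%N & is_intpart s].
Proof.
rewrite /is_intpart inE negb_or lt0n (eq_sym 0%N).
by case: k => [|k]; rewrite ?andbF //; case: s => [|l s] //=; rewrite andbA.
Qed.

Lemma mem_box M N s :
  s \in box M N = [&& is_intpart s, size s <= M & head 0 s <= N]%N.
Proof.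
elim: M N s => [|M IHM] N s.
  by case: s => [|k s]; rewrite inE //= andbF.
elim: N s => [|N IHN] s.
  case: s => [|k s]; rewrite inE //= is_intpart_cons leqn0.
  by case: k => [|k]; rewrite /= ?andbF.
rewrite boxSS mem_cat IHN.
case: s => [|k s] //=.
have -> : (k :: s \in map (cons N.+1) (box M N.+1))
    = (k == N.+1) && (s \in box M N.+1).
  apply/mapP/andP => [[s' s'b [-> ->]]|[/eqP-> sb]]; first by rewrite eqxx.
  by exists s.
rewrite IHM ltnS is_intpart_cons (leq_eqVlt k N.+1) ltnS.
case: eqP => [->|_] /=; last by rewrite orbF.
by rewrite ltnn !andbF andbT -[RHS]andbA [LHS]andbA [LHS]andbC.
Qed.

Lemma box_uniq M N : uniq (box M N).
Proof.
elim: M N => // M IHM; elim=> // N IHN.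
rewrite boxSS cat_uniq IHN map_inj_uniq ?IHM ?andbT => [|s t []//].
apply/hasPn => _ /mapP[s sb ->]; rewrite mem_box /= ltnn.
by rewrite !andbF.
Qed.

Lemma is_intpart_sumn s :
  is_intpart s -> (size s <= sumn s)%N /\ (head 0 s <= sumn s)%N.
Proof.
elim: s => // k s IHs; rewrite is_intpart_cons => /and3P[k0 _ /IHs[ss _]] /=.
split; last exact: leq_addr.
by rewrite -add1n leq_add.
Qed.

(** * Convergence of the bounded generating functions *)

Section Limit.
Variables (n : nat) (R : comNzRingType).
Implicit Types a b c d : fps n R.

Lemma order_ge_row_weight a b k :
  order_ge 1 a -> order_ge 1 b -> order_ge k (row_weight a b k).
Proof.
move=> a1 b1.
have := order_geM (order_geX (i := uphalf k) a1) (order_geX (i := half k) b1).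
by rewrite !mul1n {1}uphalf_half -addnA addnn odd_double_half.
Qed.

Lemma order_ge_row_weights a b c d s :
    order_ge 1 a -> order_ge 1 b -> order_ge 1 c -> order_ge 1 d ->
  order_ge (sumn s) (row_weights a b c d s).
Proof.
elim: s a b c d => //= k s IHs a b c d a1 b1 c1 d1.
by apply: order_geM; [apply: order_ge_row_weight | apply: IHs].
Qed.

Lemma row_weight_unit a b c d k :
    order_ge 1 a -> order_ge 1 b -> order_ge 1 c -> order_ge 1 d ->
  1 - row_weight a b k.+1 * row_weight c d k.+1 \is a GRing.unit.
Proof.
move=> a1 b1 c1 d1; apply/order_ge_unit/order_geMr.
exact: order_geW (order_ge_row_weight a1 b1).
Qed.

Lemma order_ge_pgfS N a b c d :
    order_ge 1 a -> order_ge 1 b -> order_ge 1 c -> order_ge 1 d ->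
  order_ge N.+1 (pgf N.+1 a b c d - pgf N a b c d).
Proof.
move=> a1 b1 c1 d1; rewrite pgfS ?row_weight_unit // addrC addKr.
exact/order_geMr/order_ge_row_weight.
Qed.

Lemma order_ge_pgf N N' a b c d :
    order_ge 1 a -> order_ge 1 b -> order_ge 1 c -> order_ge 1 d ->
  (N <= N')%N -> order_ge N.+1 (pgf N' a b c d - pgf N a b c d).
Proof.
move=> a1 b1 c1 d1 /subnKC <-; elim: (_ - _)%N => [|k IHk].
  by rewrite addn0 subrr.
rewrite addnS -(subrK (pgf (N + k) a b c d) (pgf _.+1 _ _ _ _)) -addrA.
apply: order_geD IHk; apply: order_geW (order_ge_pgfS a1 b1 c1 d1).
by rewrite ltnS leq_addr.
Qed.

(** Both terms obey the recursion of [pgfS], so the error stems from [M = 0], where 1 replaces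
    [pgf N], and has order at least 1. Each further row multiplies it by a row weight of order at
    least 1. *)
Lemma order_ge_box M N a b c d :
    order_ge 1 a -> order_ge 1 b -> order_ge 1 c -> order_ge 1 d ->
  order_ge M.+1 (\sum_(s <- box M N) row_weights a b c d s - pgf N a b c d).
Proof.
elim: M N a b c d => [|M IHM] N a b c d a1 b1 c1 d1.
  rewrite big_seq1 /= -opprB; apply: order_geN.
  exact: (order_ge_pgf (N := 0)).
elim: N => [|N IHN]; first by rewrite big_seq1 subrr.
rewrite boxSS big_cat big_map /= pgfS ?row_weight_unit // -mulr_sumr.
rewrite opprD addrACA -mulrBr; apply: order_geD => //.
apply: (@order_geM _ _ 1); last exact: IHM.
exact: order_geW (order_ge_row_weight a1 b1).
Qed.

End Limit.

(** * Iteration of the functional equation and the infinite product *)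

Section Product.
Variables (n : nat) (R : comNzRingType) (a b c d : fps n R).
Hypotheses (a1 : order_ge 1 a) (b1 : order_ge 1 b).
Hypotheses (c1 : order_ge 1 c) (d1 : order_ge 1 d).
Let x := a * b.
Let q := a * b * (c * d).

Let x1 : order_ge 1 x. Proof. exact: order_geMr. Qed.
Let q1 : order_ge 1 q. Proof. exact: order_geMr. Qed.

Lemma one_sub_qX_unit j : 1 - q ^+ j.+1 \is a GRing.unit.
Proof. by apply: order_ge_unit; rewrite exprS; apply: order_geMr. Qed.

Lemma one_sub_acqX_unit j : 1 - a * c * q ^+ j \is a GRing.unit.
Proof. by apply/order_ge_unit/order_geMr/order_geMr. Qed.

(** Makes P converge at t = 1. The recurrence multiplies the preceding coefficient by a series of
    order at least 1 and the one before it by a series of order at least 2, hence the induction on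
    two consecutive indices. *)
Lemma order_ge_dpgf_num j : order_ge j (dpgf_num a b c d j).
Proof.
suff [] : order_ge j (dpgf_num a b c d j)
  /\ order_ge j.+1 (dpgf_num a b c d j.+1) by [].
elim: j => [|j [IHj IHj1]]; split=> //.
  apply: (order_ge_unitM (one_sub_qX_unit 0)).
  rewrite expr1 dpgf_num1; [|exact: one_sub_qX_unit|exact: one_sub_acqX_unit].
  by do ?[apply: order_geD => //]; apply: order_geMl.
apply: (order_ge_unitM (one_sub_qX_unit j.+1)).
rewrite dpgf_numSS; [|exact: one_sub_qX_unit|exact: one_sub_acqX_unit].
rewrite -/q -/x; apply: order_geD.
  apply: (@order_geM _ _ 1) => //; apply: order_geD; first exact: order_geD.
  by apply/order_geMr/order_geD => //; apply: order_geMr.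
apply: (@order_geM _ _ 2) => //; apply: order_geB.
  by rewrite -mulrA -[2%N]/(1 + 1)%N; apply: order_geM; apply: order_geMr.
exact: (@order_geM _ _ 1 1).
Qed.

Definition dpgf_num_series N t :=
  \sum_(j < N.+1) dpgf_num a b c d j * t ^+ j.

Lemma order_ge_dpgf_num_series N t :
  order_ge N.+1 ((1 - q * t) * (1 - x * t) * dpgf_num_series N t
    - (1 + a * t) * (1 + c * x * t) * dpgf_num_series N (q * t)).
Proof.
rewrite dpgf_num_functional_eq; [|exact: one_sub_qX_unit|exact: one_sub_acqX_unit].
apply: order_geD; first exact/order_geMl/order_ge_dpgf_num.
rewrite -/x -2!mulrA; apply: order_geMl; apply: (@order_geM _ _ 1) => //.
exact/order_geMl/order_ge_dpgf_num.
Qed.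

Lemma order_ge_pgf_num N :
  order_ge N (\prod_(k < N) ((1 - q ^+ k.+1) * (1 - x * q ^+ k))
      * pgf_num a b c d N
    - \prod_(k < N) ((1 + a * q ^+ k) * (1 + c * x * q ^+ k))).
Proof.
(* The functional equation is applied [K] times, at t = 1, q, ..., q^(K-1). *)
have step K : order_ge N
    (\prod_(k < K) ((1 - q ^+ k.+1) * (1 - x * q ^+ k)) * dpgf_num_series N 1
    - \prod_(k < K) ((1 + a * q ^+ k) * (1 + c * x * q ^+ k))
      * dpgf_num_series N (q ^+ K)).
  elim: K => [|K IHK]; first by rewrite !big_ord0 expr0 subrr.
  rewrite !big_ord_recr /=.
  set P := \prod_(i < K) _ in IHK *; set Q := \prod_(i < K) _ in IHK *.
  (* With [U] the truncated P at [q ^+ K], the first summand is the induction hypothesis and the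
     second the functional equation at that point. *)
  have e : forall A B S T U : fps n R, P * A * S - Q * B * T
      = A * (P * S - Q * U) + Q * (A * U - B * T) by move=> *; ring.
  rewrite (e _ _ _ _ (dpgf_num_series N (q ^+ K))) exprS.
  apply: order_geD; first exact: order_geMl.
  apply: order_geMl.
  exact: order_geW (order_ge_dpgf_num_series _).
have pgf1 : dpgf_num_series N 1 = pgf_num a b c d N.
  by rewrite -sum_dpgf_num; apply: eq_bigr => j _; rewrite expr1n mulr1.
(* At t = q^N only the constant term 1 survives below degree N. *)
have pgfq : order_ge N (dpgf_num_series N (q ^+ N) - 1).
  rewrite /dpgf_num_series big_ord_recl expr0 mulr1 addrC addKr.
  apply: order_ge_sum => j; rewrite exprS; apply/order_geMl/order_geMr.
  by have := order_geX (i := N) q1; rewrite mul1n.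
have := step N; rewrite pgf1; set S := dpgf_num_series _ _ in pgfq *.
set P := _ * pgf_num _ _ _ _ _; set Q := \prod_(k < N) _ => PQ.
have -> : P - Q = P - Q * S + Q * (S - 1) by ring.
by apply: order_geD => //; apply: order_geMl.
Qed.

(** By [order_ge_pgf], the coefficients of degree D in [pgf N] are constant from N = D on, so the
    limit is read off diagonally. *)
Definition pgf_lim : fps n R := Fps (fun m => fcoef (pgf (mdeg m) a b c d) m).

Lemma order_ge_pgf_lim N : order_ge N.+1 (pgf_lim - pgf N a b c d).
Proof.
move=> m; rewrite ltnS fcoefD fcoefN /= => mN.
have := order_ge_pgf a1 b1 c1 d1 mN (ltnSn _); rewrite fcoefD fcoefN => e.
by rewrite -opprB e oppr0.
Qed.

Lemma fps_sum_weight : fps_sum (weight a b c d) pgf_lim.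
Proof.
(* A weight has order at least the sum of the parts, which exceeds [D] outside the [D] by [D]
   box. *)
move=> m; pose D := mdeg m; exists (pmap insub (box D D)); split.
- exact/pmap_sub_uniq/box_uniq.
- move=> l; rewrite mem_pmap_sub mem_box (valP l) andTb => lD.
  rewrite weightE; apply: order_ge_row_weights => //.
  have [ls lh] := is_intpart_sumn (valP l).
  move: lD; rewrite negb_and -!ltnNge.
  by case/orP => /leq_trans; apply.
have -> : fcoef pgf_lim m = fcoef (\sum_(s <- box D D) row_weights a b c d s) m.
  apply/esym/eqP; rewrite -subr_eq0 -fcoefN -fcoefD; apply/eqP.
  exact: (order_ge_box (M := D) D a1 b1 c1 d1).
have fcoef_sum (I : Type) (r : seq I) (F : I -> fps n R) :
    fcoef (\sum_(i <- r) F i) m = \sum_(i <- r) fcoef (F i) m.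
  by apply: (big_morph (fun f : fps n R => fcoef f m)).
rewrite fcoef_sum.
have boxE : map val (pmap insub (box D D) : seq intpart) = box D D.
  rewrite (pmap_filter (insubK _)) (eq_filter (isSome_insub _)).
  by apply/all_filterP/allP => s; rewrite mem_box => /andP[].
by rewrite -[in LHS]boxE big_map; apply: eq_bigr => l _; rewrite weightE.
Qed.

Lemma fps_prod_pgf_lim :
  fps_prod (fun j : nat =>
      ((1 + a ^+ j * b ^+ j.-1 * c ^+ j.-1 * d ^+ j.-1)
         * (1 + a ^+ j * b ^+ j * c ^+ j * d ^+ j.-1))
      / ((1 - a ^+ j * b ^+ j * c ^+ j * d ^+ j)
         * (1 - a ^+ j * b ^+ j * c ^+ j.-1 * d ^+ j.-1)
         * (1 - a ^+ j * b ^+ j.-1 * c ^+ j * d ^+ j.-1))) pgf_lim.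
Proof.
apply: order_ge_lim => N; rewrite big_add1 big_mkord.
pose den k := (1 - q ^+ k.+1) * (1 - x * q ^+ k) * (1 - a * c * q ^+ k).
pose num k := (1 + a * q ^+ k) * (1 + c * x * q ^+ k).
have denU k : den k \is a GRing.unit.
  rewrite /den !unitrM one_sub_qX_unit one_sub_acqX_unit andbT /=.
  exact/order_ge_unit/order_geMr.
rewrite (eq_bigr (fun k : 'I_N => num k / den k)); last first.
  move=> k _; rewrite /num /den /q /x !exprMn !exprS.
  move: (a ^+ k) (b ^+ k) (c ^+ k) (d ^+ k) => ak bk ck dk /=.
  by congr (_ / _); ring.
apply: (order_ge_unitM (u := \prod_(k < N) den k)).
  by apply: rpred_prod.
rewrite mulrBr -big_split /=.
under eq_bigr do rewrite mulrC divrK //.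
(* The factors 1 - ac q^k of [den] turn [pgf N.*2] into [pgf_num N]; replacing the limit by
   [pgf N.*2] costs an error of order at least 2N+1. *)
have -> : \prod_(k < N) den k * pgf_lim
    = \prod_(k < N) ((1 - q ^+ k.+1) * (1 - x * q ^+ k)) * pgf_num a b c d N
      + \prod_(k < N) den k * (pgf_lim - pgf N.*2 a b c d).
  rewrite mulrBr addrC /pgf_num [X in _ = _ - _ + X]mulrA.
  rewrite -[X in _ = _ + X * _]big_split.
  by rewrite subrK.
rewrite opprD addrA; apply: order_geB.
  by rewrite -opprB; apply/order_geN/order_ge_pgf_num.
apply: order_geMl; apply: order_geW (@order_ge_pgf_lim N.*2).
by rewrite -addnn -addnS leq_addr.
Qed.

End Product.

Theorem theorem1 (R : comNzRingType) :
  let a : fps 4 R := fvar R (@inord 3 0) in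
  let b : fps 4 R := fvar R (@inord 3 1) in
  let c : fps 4 R := fvar R (@inord 3 2) in
  let d : fps 4 R := fvar R (@inord 3 3) in
  exists Phi : fps 4 R,
    fps_sum (weight a b c d) Phi /\
    fps_prod (fun j : nat =>
      ((1 + a ^+ j * b ^+ j.-1 * c ^+ j.-1 * d ^+ j.-1)
         * (1 + a ^+ j * b ^+ j * c ^+ j * d ^+ j.-1))
      / ((1 - a ^+ j * b ^+ j * c ^+ j * d ^+ j)
         * (1 - a ^+ j * b ^+ j * c ^+ j.-1 * d ^+ j.-1)
         * (1 - a ^+ j * b ^+ j.-1 * c ^+ j * d ^+ j.-1))) Phi.
Proof.
move=> a b c d; exists (pgf_lim a b c d).
by split; [apply: fps_sum_weight | apply: fps_prod_pgf_lim];
  apply: order_ge_fvar.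
Qed.
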